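(* Let $|\varphi\rangle$ be an injective PEPS on a finite connected graph (lattice) $(V,\mathcal{E})$, i.e. there is a covering $V=\bigsqcup_\alpha R_\alpha$ by at least two disjoint connected injective regions. Then there is a local, frustration-free Hamiltonian of which $|\varphi\rangle$ is the unique ground state. That is, there is a Hamiltonian $$H=\sum_{(\alpha,\beta)} h_{\alpha,\beta}\otimes \mathbb{1},$$ where the sum runs over all unordered pairs $(\alpha,\beta)$, $\alpha\neq\beta$, such that $R_\alpha$ and $R_\beta$ are joined by at least one edge of the graph, $h_{\alpha,\beta}\ge 0$ acts on $\mathcal{H}_{R_\alpha\cup R_\beta}$ (and $\mathbb{1}$ is the identity on all remaining sites), $(h_{\alpha,\beta}\otimes\mathbb{1})|\varphi\rangle=0$ for every such pair $(\alpha,\beta)$, and $\ker H=\mathbb{C}\,|\varphi\rangle$ is one-dimensional.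
   Context: Let $(V,\mathcal{E})$ be a finite graph without loops (multiple edges allowed) and let $d,D\ge 1$ be integers. Each vertex $v$ carries a physical space $\mathbb{C}^d$ with basis $|1\rangle,\dots,|d\rangle$, and tensors $A^{(v)}_i$ ($i=1,\dots,d$) having one $D$-dimensional index for each edge adjacent to $v$. A region is a nonempty subset $R\subseteq V$; put $\mathcal{H}_R=(\mathbb{C}^{d})^{\otimes |R|}$, and let $e_R$ be the number of edges with exactly one endpoint in $R$ (outgoing edges). For $i_R=(i_v)_{v\in R}$, let $A_{i_R}$ be the tensor with $e_R$ open indices obtained from $(A^{(v)}_{i_v})_{v\in R}$ by contracting (identifying and summing) the indices belonging to the same edge, for all edges with both endpoints in $R$. For a tensor $C$ with $e_R$ $D$-dimensional indices (one per outgoing edge), define the linear map $$\Gamma_R:(\mathbb{C}^{D})^{\otimes e_R}\to \mathcal{H}_R,\qquad \Gamma_R(C)=\sum_{i_R}\mathcal{C}[A_{i_R}C]\,|i_R\rangle,$$ where $\mathcal{C}[A_{i_R}C]$ is the (bilinear) full contraction of the indices of $A_{i_R}$ with the corresponding ones of $C$. The region $R$ is called injective if $\Gamma_R$ is injective. The PEPS is $|\varphi\rangle=\Gamma_V(1)=\sum_{i}\mathcal{C}[\{A^{(v)}_{i_v}\}_v]\,|i\rangle$; it is called injective if $V$ can be covered by disjoint connected injective regions. A region is connected if the subgraph it induces is connected. ''Local'' means, as in the displayed form of $H$, that every interaction term involves only two neighbouring regions of the covering; ''frustration-free'' means that the state minimizes the energy of every interaction term. *)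

(* Defs.v *)
From HB Require Import structures.
From mathcomp Require Import all_boot all_order all_algebra.
From mathcomp Require Export reals complex.
Set Implicit Arguments.
Unset Strict Implicit.
Unset Printing Implicit Defensive.
Import Order.TTheory GRing.Theory Num.Theory.
Local Open Scope ring_scope.

(* Values in {0, ..., n-1} on the points of S, i.e. a multi-index for a tensor
   whose n-dimensional indices are in bijection with S. *)
Definition labelling (T : finType) (n : nat) (S : {set T}) : finType :=
  {ffun {x : T | x \in S} -> 'I_n}.

(* (C^n)^{(x) #|S|}, one tensor factor per element of S, in coordinates with
   respect to the product basis indexed by the labellings of S. *)
Notation tensor C n S := {ffun labelling n S -> C^o}.

Section Labelling.
Variables (T : finType) (n : nat).
Implicit Types S U : {set T}.

Definition restrict S U (sSU : S \subset U) (c : labelling n U) :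
    labelling n S :=
  [ffun x => c (exist _ (val x) (subsetP sSU (val x) (valP x)))].

(* The labelling equal to j on S and to i off S. *)
Definition override S (j : labelling n S) (i : labelling n [set: T]) :
    labelling n [set: T] :=
  [ffun x => if insub (val x) is Some y then j y else i x].

End Labelling.

Section Hilbert.
Variables (C : numClosedFieldType) (T : finType) (n : nat).
Implicit Types S : {set T}.

Definition inner S (x y : tensor C n S) : C := \sum_i (x i)^* * y i.

Definition psd S (h : 'End(tensor C n S)) : Prop :=
  (forall x y, inner x (h y) = inner (h x) y) /\
  (forall x, 0 <= inner x (h x)).

(* h (x) 1: h acts on the sites of S, the other coordinates being fixed. *)
Definition ampliate_fun S (h : 'End(tensor C n S))
    (psi : tensor C n [set: T]) : tensor C n [set: T] :=
  [ffun i => h [ffun j => psi (override j i)] (restrict (subsetT S) i)].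

Lemma ampliate_fun_is_linear S (h : 'End(tensor C n S)) :
  linear (ampliate_fun h).
Proof.
move=> a u v; apply/ffunP=> i; rewrite !ffunE.
have -> : [ffun j => (a *: u + v) (override j i)] =
   a *: [ffun j => u (override j i)] + [ffun j => v (override j i)]
     :> tensor C n S by apply/ffunP=> j; rewrite !ffunE.
by rewrite linearP !ffunE.
Qed.

HB.instance Definition _ S (h : 'End(tensor C n S)) :=
  GRing.isLinear.Build C (tensor C n [set: T]) (tensor C n [set: T]) _
    (ampliate_fun h) (ampliate_fun_is_linear h).

Definition ampliate S (h : 'End(tensor C n S)) : 'End(tensor C n [set: T]) :=
  linfun (ampliate_fun h).

Lemma ampliateE S (h : 'End(tensor C n S)) psi i :
  ampliate h psi i =
  h [ffun j => psi (override j i)] (restrict (subsetT S) i).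
Proof. by rewrite lfunE ffunE. Qed.

End Hilbert.

Section Graph.
Variables V E : finType.

(* A multigraph is given by the set of endpoints of each edge; a loop would be
   an edge with a single endpoint. *)
Definition loopless (ends : E -> {set V}) : Prop := forall e, #|ends e| = 2%N.

Variable ends : E -> {set V}.
Implicit Types S T : {set V}.

Definition adjacent (u v : V) : bool := [exists e, ends e == [set u; v]].

Definition connected_in S : Prop :=
  {in S &, forall u v,
    connect [rel x y | [&& x \in S, y \in S & adjacent x y]] u v}.

Definition joined S T : bool :=
  [exists u in S, exists v in T, adjacent u v].

Definition neighbour_pairs (P : {set {set V}}) : {set {set {set V}}} :=
  [set [set S; T] | S in P, T in P & (S != T) && joined S T].

Definition incident (v : V) : {set E} := [set e | v \in ends e].
Definition touching S : {set E} := [set e | ends e :&: S != set0].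
Definition outgoing S : {set E} := [set e | #|ends e :&: S| == 1%N].

Lemma incident_touching S (v : {v | v \in S}) :
  incident (val v) \subset touching S.
Proof.
apply/subsetP=> e; rewrite !inE => ve; apply/set0Pn.
by exists (val v); rewrite inE ve (valP v).
Qed.

Lemma outgoing_touching S : outgoing S \subset touching S.
Proof.
apply/subsetP=> e; rewrite !inE => /eqP e1; apply/negP => /eqP e0.
by rewrite e0 cards0 in e1.
Qed.

End Graph.

Section PEPS.
Variables (C : numClosedFieldType) (V E : finType) (ends : E -> {set V}).
Variables (d D : nat).

Definition peps_tensors : Type :=
  forall v : V, 'I_d -> tensor C D (incident ends v).

Variable A : peps_tensors.

(* The tensor A_{i_S}: for fixed values o of the open indices, the sum runs over
   the values of the indices on the edges with both endpoints in S. *)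
Definition contract (S : {set V}) (i : labelling d S) :
    tensor C D (outgoing ends S) :=
  [ffun o => \sum_(c : labelling D (touching ends S)
                    | restrict (outgoing_touching ends S) c == o)
     \prod_(v : {v | v \in S})
        A (val v) (i v) (restrict (incident_touching ends v) c)].

Definition Gamma (S : {set V}) (X : tensor C D (outgoing ends S)) :
    tensor C d S :=
  [ffun i => \sum_o contract i o * X o].

Lemma Gamma_is_linear S : linear (@Gamma S).
Proof.
move=> a X Y; apply/ffunP=> i; rewrite !ffunE scaler_sumr -big_split /=.
by apply: eq_bigr => o _; rewrite !ffunE mulrDr /GRing.scale /= mulrCA.
Qed.

HB.instance Definition _ S :=
  GRing.isLinear.Build C (tensor C D (outgoing ends S)) (tensor C d S) _
    (@Gamma S) (@Gamma_is_linear S).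

Definition injective_region (S : {set V}) : Prop := injective (@Gamma S).

(* No edge is outgoing from the whole graph, so the argument of Gamma here is
   the scalar 1. *)
Definition peps : tensor C d [set: V] := Gamma (S := [set: V]) [ffun=> 1].

Definition injective_covering (P : {set {set V}}) : Prop :=
  partition P [set: V] /\
  {in P, forall S, connected_in ends S /\ injective_region S}.

(* cover p is the union of the two regions of the unordered pair p. *)
Definition hamiltonian (P : {set {set V}})
    (h : forall p : {set {set V}}, 'End(tensor C d (cover p))) :
    'End(tensor C d [set: V]) :=
  \sum_(p in neighbour_pairs ends P) ampliate (h p).

End PEPS.

(* Main.v *)
(* Let gamma_S(i, c) be the amplitude of a region S for physical labels i and
   bond labels c.  Up to nonzero factors, the amplitude of a disjoint union of S
   and T is the average of gamma_S gamma_T over the labels of the bonds between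
   S and T.

   The interaction term of a neighbouring pair S, T is f^* f, where f is a
   projection whose kernel is the image of Gamma_{S u T}.  H being a sum of
   nonnegative terms, its kernel consists of the psi lying in the image of
   Gamma_{S u T} (x) 1 for all neighbouring pairs.  Injectivity of the regions
   gives functionals dual to the gamma_S, and psi is determined by its pairings
   X(y) with their products, where y assigns to each region labels of its
   outgoing bonds.  The condition at the pair S, T says that X(y) vanishes unless
   y_S and y_T agree on the bonds between S and T, and that X(y) does not depend
   on the common labels.  Hence X is supported on globally consistent labels and
   constant there, so psi is determined by one number.  The PEPS is nonzero since
   some product of dual functionals pairs with it positively. *)
From HB Require Import structures.
Require Import Defs.
From mathcomp Require Import all_boot all_order all_algebra.
From mathcomp Require Import perm ring.
Set Implicit Arguments.
Unset Strict Implicit.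
Unset Printing Implicit Defensive.
Import Order.TTheory GRing.Theory Num.Theory.
Local Open Scope ring_scope.

(** * Averages over configurations *)

Section Averaging.
Variables (C : numFieldType) (T K : finType).
Local Notation cfg := {ffun T -> K}.
Implicit Types (M S : {set T}) (x y z : cfg) (f h : cfg -> C).

Definition mix M x y : cfg := [ffun t => if t \in M then x t else y t].

Definition depends_on S f := forall x y, {in S, x =1 y} -> f x = f y.

Lemma depends_onW S S' f : S \subset S' -> depends_on S f -> depends_on S' f.
Proof. by move=> /subsetP sS dep x y xy; apply: dep => t /sS; apply: xy. Qed.

Lemma depends_onM S f h :
  depends_on S f -> depends_on S h -> depends_on S (fun x => f x * h x).
Proof. by move=> df dh x y xy; rewrite (df x y) ?(dh x y). Qed.

Lemma depends_on_prod S (I : Type) (r : seq I) (Q : pred I)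
    (F : I -> cfg -> C) :
  (forall k, Q k -> depends_on S (F k)) ->
  depends_on S (fun x => \prod_(k <- r | Q k) F k x).
Proof. by move=> dF x y xy; apply: eq_bigr => k Qk; apply: dF. Qed.

Lemma mixK M x z : mix M (mix M x z) (mix M z x) = x.
Proof. by apply/ffunP=> t; rewrite !ffunE; case: (t \in M). Qed.

(** Exchanging the coordinates in [M] between [x] and [z] is an involution on pairs, after which the
    summand depends on one component only. *)
Lemma sum_mix M (F : cfg -> C) :
  \sum_x \sum_z F (mix M z x) = #|{: cfg}|%:R * \sum_w F w.
Proof.
pose s (p : cfg * cfg) := (mix M p.2 p.1, mix M p.1 p.2).
have sK : involutive s by case=> x z; rewrite /s /= !mixK.
rewrite pair_big /= (reindex_inj (inv_inj sK)) /=.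
under eq_bigr => p _ do rewrite mixK.
rewrite -(pair_big xpredT xpredT (fun x _ => F x)) /= mulr_sumr.
by apply: eq_bigr => x _; rewrite sumr_const mulr_natl.
Qed.

Lemma sum_mul_indep S f h : depends_on S f -> depends_on (~: S) h ->
  (\sum_x f x) * (\sum_x h x) = #|{: cfg}|%:R * \sum_x f x * h x.
Proof.
move=> df dh; rewrite -(sum_mix S) mulr_suml exchange_big /=.
apply: eq_bigr => x _; rewrite mulr_sumr; apply: eq_bigr => z _.
congr (_ * _); [apply: df | apply: dh] => t; rewrite ?inE ffunE => tS.
  by rewrite tS.
by rewrite (negPf tS).
Qed.

(* The conditional expectation that integrates out the coordinates in M. *)
Definition avg M f y : C := #|{: cfg}|%:R^-1 * \sum_x f (mix M x y).

Lemma cfg_neq0 y : #|{: cfg}|%:R != 0 :> C.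
Proof. by rewrite pnatr_eq0 -lt0n; apply/card_gt0P; exists y. Qed.

Lemma avg_mul M f h y : depends_on (~: M) f ->
  avg M (fun x => f x * h x) y = f y * avg M h y.
Proof.
move=> df; rewrite /avg [RHS]mulrCA [f y * _]mulr_sumr; congr (_ * _).
apply: eq_bigr => x _; congr (_ * _); apply: df => t.
by rewrite !inE ffunE => /negPf->.
Qed.

Lemma avg_cst M (a : C) y : avg M (fun=> a) y = a.
Proof. by rewrite /avg sumr_const -[a *+ _]mulr_natl mulKf ?cfg_neq0. Qed.

Lemma eq_avg M f h y : f =1 h -> avg M f y = avg M h y.
Proof. by move=> fh; congr (_ * _); apply: eq_bigr => x _. Qed.

(** Tower property: two independent resamplings, of [M] and of [M'], combine by [sum_mix] into one
    resampling of the union. *)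
Lemma avg_avg M M' f y : avg M (avg M' f) y = avg (M' :|: M) f y.
Proof.
rewrite /avg -mulr_sumr; congr (_ * _).
rewrite -[RHS](mulKf (cfg_neq0 y)) -(sum_mix M'); congr (_ * _).
apply: eq_bigr => x _; apply: eq_bigr => z _; congr f.
by apply/ffunP=> t; rewrite !ffunE !inE; case: (t \in M').
Qed.

Lemma depends_on_avg S M f : depends_on S f -> depends_on (S :\: M) (avg M f).
Proof.
move=> df x y xy; congr (_ * _); apply: eq_bigr => z _; apply: df => t tS.
by rewrite !ffunE; case: ifPn => // tM; apply: xy; rewrite inE tM.
Qed.

End Averaging.

(** * Labellings of a set as restrictions of global configurations *)

Section Restriction.
Variables (T : finType) (n : nat).
Local Notation cfg := {ffun T -> 'I_n}.
Implicit Types (S U : {set T}) (x y : cfg).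

(** Amplitudes below take labels on all of [V] and [E], so that different regions share one type of
    arguments; [rs] and [patch] translate to and from labellings. *)
Definition rs S x : labelling n S := [ffun t => x (val t)].

Definition patch S (j : labelling n S) x : cfg :=
  [ffun t => if insub t is Some u then j u else x t].

Lemma rs_patch S (j : labelling n S) x : rs S (patch j x) = j.
Proof. by apply/ffunP=> t; rewrite !ffunE valK. Qed.

Lemma patch_rs S x y : patch (rs S x) y = mix S x y.
Proof.
apply/ffunP=> t; rewrite !ffunE; case: insubP => [u tS <-|/negPf->] //.
by rewrite ffunE (valP u).
Qed.

Lemma patch_patch S (j j' : labelling n S) x : patch j (patch j' x) = patch j x.
Proof.
by apply/ffunP=> t; rewrite !ffunE; case: insubP.
Qed.

Lemma patch_off S (j : labelling n S) x t : t \notin S -> patch j x t = x t.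
Proof. by move=> tS; rewrite ffunE insubN. Qed.

Lemma patch_id S x : patch (rs S x) x = x.
Proof. by rewrite patch_rs; apply/ffunP=> t; rewrite ffunE if_same. Qed.

Lemma rsP S x y : reflect {in S, x =1 y} (rs S x == rs S y).
Proof.
apply: (iffP eqP) => [/ffunP xy t tS | xy].
  by have := xy (exist _ t tS); rewrite !ffunE.
by apply/ffunP=> t; rewrite !ffunE; apply: xy; apply: valP.
Qed.

Lemma restrict_rs S U (sSU : S \subset U) x : restrict sSU (rs U x) = rs S x.
Proof. by apply/ffunP=> t; rewrite !ffunE. Qed.

Lemma override_rs S (j : labelling n S) x :
  override j (rs setT x) = rs setT (patch j x).
Proof. by apply/ffunP=> t; rewrite !ffunE; case: insubP. Qed.

Lemma rs_bij : bijective (rs setT).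
Proof.
exists (fun j : labelling n setT => [ffun t => j (exist _ t (in_setT t))]).
  by move=> x; apply/ffunP=> t; rewrite !ffunE.
by move=> j; apply/ffunP=> t; rewrite !ffunE; congr (j _); apply: val_inj.
Qed.

Lemma sum_patch (C : numFieldType) S (F : cfg -> C) :
  \sum_x \sum_(j : labelling n S) F (patch j x)
    = #|{: labelling n S}|%:R * \sum_x F x.
Proof.
pose s (p : cfg * labelling n S) := (patch p.2 p.1, rs S p.1).
have sK : involutive s.
  by case=> x j; rewrite /s /= rs_patch patch_patch patch_id.
rewrite pair_big /= (reindex_inj (inv_inj sK)) /=.
under eq_bigr => p _ do rewrite patch_patch patch_id.
rewrite -(pair_big xpredT xpredT (fun x _ => F x)) /= mulr_sumr.
by apply: eq_bigr => x _; rewrite sumr_const mulr_natl.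
Qed.

Lemma sum_rs (C : numFieldType) S (F : labelling n S -> C) :
  #|{: labelling n S}|%:R * \sum_x F (rs S x) = #|{: cfg}|%:R * \sum_j F j.
Proof.
rewrite -sum_patch mulr_natl -sumr_const; apply: eq_bigr => x _.
by apply: eq_bigr => j _; rewrite rs_patch.
Qed.

End Restriction.

(** * Amplitudes of regions *)

Section Edges.
Variables (V E : finType) (ends : E -> {set V}).
Implicit Types S T : {set V}.
Local Notation out := (outgoing ends).

Definition internal S : {set E} := [set e | #|ends e :&: S| == 2%N].

Lemma card_ends_setU S T e : [disjoint S & T] ->
  #|ends e :&: (S :|: T)| = (#|ends e :&: S| + #|ends e :&: T|)%N.
Proof.
move=> dST; rewrite setIUr cardsU -setIIr.
by rewrite (disjoint_setI0 dST) setI0 cards0 subn0.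
Qed.

Lemma outgoing_setT : loopless ends -> out setT = set0.
Proof. by move=> ll; apply/setP=> e; rewrite !inE setIT ll. Qed.

Lemma card_ends_setU_le S T e : loopless ends -> [disjoint S & T] ->
  (#|ends e :&: S| + #|ends e :&: T| <= 2)%N.
Proof.
move=> ll dST; rewrite -card_ends_setU // -(ll e).
exact: subset_leq_card (subsetIl _ _).
Qed.

Lemma touching_internal S T :
  loopless ends -> [disjoint S & T] -> touching ends S \subset ~: internal T.
Proof.
move=> ll dST; apply/subsetP=> e; have := card_ends_setU_le e ll dST.
rewrite !inE -card_gt0 => le2 S_gt0; apply/eqP=> T2.
by move: le2; rewrite T2 leqNgt addn2 !ltnS S_gt0.
Qed.

(** Counting the ends of an edge in [S] and in [T] settles all cases. The nesting of the unions is
    the order of the averages in [region_amp_setU]. *)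
Lemma internal_setU S T : loopless ends -> [disjoint S & T] ->
  internal (S :|: T) = (internal T :|: (internal S :|: (out S :&: out T))).
Proof.
move=> ll dST; apply/setP=> e; rewrite !inE card_ends_setU //.
have := card_ends_setU_le e ll dST.
by case: #|_| => [|[|[|m]]]; case: #|_| => [|[|[|k]]].
Qed.

Lemma outgoing_setI_joined S T e : loopless ends -> [disjoint S & T] ->
  e \in out S -> e \in out T -> joined ends S T.
Proof.
move=> ll dST; rewrite !inE => /cards1P[s sE] /cards1P[t tE].
have /setIP[se sS] : s \in ends e :&: S by rewrite sE set11.
have /setIP[te tT] : t \in ends e :&: T by rewrite tE set11.
apply/existsP; exists s; rewrite sS; apply/existsP; exists t; rewrite tT.
apply/existsP; exists e; rewrite eq_sym eqEcard ll cards2 subUset !sub1set se te.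
rewrite (_ : s != t) //; apply: contraTneq sS => ->.
by rewrite (disjointFl dST tT).
Qed.

End Edges.

Section Peps.
Variables (C : numClosedFieldType) (V E : finType) (ends : E -> {set V}).
Variables (d D : nat) (A : peps_tensors C ends d D).
Hypothesis ends_loopless : loopless ends.
Local Notation out := (outgoing ends).
Local Notation internal := (internal ends).
Implicit Types (S T : {set V}) (i : {ffun V -> 'I_d}) (c : {ffun E -> 'I_D}).

Definition site_prod S i c : C :=
  \prod_(v in S) A v (i v) (rs (incident ends v) c).

(* Averaging instead of summing over the internal bonds makes region_amp differ
   from contract by a nonzero factor, see contract_region_amp. *)
Definition region_amp S i c : C := avg (internal S) (site_prod S i) c.

(** The number of terms in the sum defining [contract], that is, [D] to the number of internal
    edges. *)
Definition fibre_card S c : C :=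
  #|[pred b | restrict (outgoing_touching ends S) b == rs (out S) c]|%:R.

Lemma fibre_card_neq0 S c : fibre_card S c != 0.
Proof.
rewrite pnatr_eq0 -lt0n; apply/card_gt0P; exists (rs _ c).
by rewrite inE restrict_rs.
Qed.

Lemma eq_fibre_card S c c' : rs (out S) c = rs (out S) c' ->
  fibre_card S c = fibre_card S c'.
Proof. by rewrite /fibre_card => ->. Qed.

Lemma touchingE S : touching ends S = out S :|: internal S.
Proof.
apply/setP=> e; rewrite !inE -card_gt0.
have := subset_leq_card (subsetIl (ends e) S); rewrite ends_loopless.
by case: #|_| => [|[|[|]]].
Qed.

Lemma site_prod_contract S i c :
  site_prod S i c = \prod_(v : {v | v \in S})
    A (val v) (rs S i v) (restrict (incident_touching ends v) (rs _ c)).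
Proof.
rewrite /site_prod big_sub /=; apply: eq_bigr => v _.
by rewrite restrict_rs ffunE.
Qed.

Lemma contract_region_amp S i c :
  contract A (rs S i) (rs (out S) c) = fibre_card S c * region_amp S i c.
Proof.
rewrite ffunE /region_amp /avg mulrCA.
pose Q (b : labelling D (touching ends S)) :=
  restrict (outgoing_touching ends S) b == rs (out S) c.
pose phi b := \prod_(v : {v | v \in S})
    A (val v) (rs S i v) (restrict (incident_touching ends v) b).
apply: (mulfI (cfg_neq0 C c)); rewrite mulVKf ?cfg_neq0 //.
rewrite -[LHS]/(_ * \sum_(b | Q b) phi b).
under [in RHS]eq_bigr => x _ do rewrite site_prod_contract -/(phi _).
rewrite /fibre_card -[[pred b | _]]/[pred b | Q b].
(* Exchanging the internal labels of x and b shows that all fibres of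
   x |-> rs (mix (internal S) x c) have the same cardinality. *)
pose s (p : {ffun E -> 'I_D} * labelling D (touching ends S)) :=
  (mix (internal S) (patch p.2 p.1) p.1,
   rs (touching ends S) (mix (internal S) p.1 c)).
have itS e : e \in internal S -> e \in touching ends S.
  by rewrite touchingE in_setU orbC => ->.
have Qs p : Q (s p).2.
  apply/eqP; rewrite restrict_rs; apply/eqP/rsP => e; rewrite !inE => eS.
  by rewrite ffunE inE (eqP eS).
have sK p : Q p.2 -> s (s p) = p.
  case: p => x b /= /eqP Qb; rewrite /s /=; congr (_, _).
    apply/ffunP=> e; rewrite ffunE patch_rs !ffunE.
    by case: (boolP (e \in internal S)) => [/itS-> | _].
  rewrite -[RHS](rs_patch b c); apply/eqP/rsP=> e.
  have -> : (e \in touching ends S) = (e \in out S) || (e \in internal S).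
    by rewrite touchingE in_setU.
  rewrite ffunE; case: ifP => [eI _|eI]; last rewrite orbF => eS.
    by rewrite ffunE eI [LHS]ffunE [RHS]ffunE; case: insubP => //; rewrite itS.
  have := congr1 (fun o : labelling D (out S) => o (exist _ e eS)) Qb.
  rewrite !ffunE /= => <-; case: insubP => [u _ ue|]; last first.
    by case/negP; apply: (subsetP (outgoing_touching ends S)).
  by congr (b _); apply: val_inj.
(* Both sides are the sum of [phi p.2] over these pairs: directly, the first component only
   contributes a factor; after applying [s], the second one does. *)
transitivity
    (\sum_(p : {ffun E -> 'I_D} * labelling D (touching ends S) | Q p.2) phi p.2).
  by rewrite -(pair_big xpredT Q (fun=> phi)) /= sumr_const mulr_natl.
rewrite (reindex_onto s s) //=.
rewrite (eq_bigl (fun p => xpredT p.1 && Q p.2)) => [|p]; last first.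
  by rewrite Qs /=; apply/eqP/idP => [<-|/sK].
rewrite -(pair_big xpredT Q
  (fun x _ => phi (rs (touching ends S) (mix (internal S) x c)))) /= mulr_sumr.
by apply: eq_bigr => x _; rewrite sumr_const mulr_natl.
Qed.
Lemma region_amp_dep_site S c : depends_on S (region_amp S ^~ c).
Proof.
move=> i i' ii'; apply: eq_avg => b; rewrite /site_prod.
by apply: eq_bigr => v vS; rewrite ii'.
Qed.

Lemma site_prod_dep S i : depends_on (touching ends S) (site_prod S i).
Proof.
move=> c c' cc'; apply: eq_bigr => v vS; congr (A _ _ _).
apply/eqP/rsP=> e ev; apply: cc'.
exact: subsetP (incident_touching ends (exist _ v vS)) _ ev.
Qed.

Lemma region_amp_dep_edge S i : depends_on (out S) (region_amp S i).
Proof.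
apply: depends_onW (depends_on_avg (@site_prod_dep S i)).
by rewrite touchingE setDUl setDv setU0 subsetDl.
Qed.

(** The internal bonds of the union are internal to [T], internal to [S], or shared. The average
    over the first kind passes through the factor of [S], that over the second through the amplitude
    of [T]. *)
Lemma region_amp_setU S T i c : [disjoint S & T] ->
  region_amp (S :|: T) i c =
  avg (out S :&: out T) (fun b => region_amp S i b * region_amp T i b) c.
Proof.
move=> dST; have dTS : [disjoint T & S] by rewrite disjoint_sym.
have site_prodU x : site_prod (S :|: T) i x = site_prod S i x * site_prod T i x.
  by rewrite /site_prod -bigU //; apply: eq_bigl => v; rewrite !inE.
have dS : depends_on (~: internal T) (site_prod S i).
  exact: (depends_onW (touching_internal ends_loopless dST) (@site_prod_dep S i)).
have dT : depends_on (~: internal S) (region_amp T i).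
  apply: depends_onW (@region_amp_dep_edge T i).
  exact: subset_trans (outgoing_touching _ _) (touching_internal ends_loopless dTS).
rewrite {1}/region_amp internal_setU // -avg_avg -avg_avg; apply: eq_avg => x.
rewrite mulrC -avg_mul //; apply: eq_avg => {}x.
by rewrite mulrC -avg_mul //; apply: eq_avg.
Qed.

Lemma tensorE n (T : finType) (S : {set T}) (x : tensor C n S) :
  x = \sum_j x j *: ([ffun k => (k == j)%:R] : tensor C n S).
Proof.
apply/ffunP=> k; rewrite sum_ffunE (bigD1 k) //= big1 => [|j jk].
  by rewrite !ffunE eqxx addr0 [RHS]mulr1.
by rewrite !ffunE eq_sym (negPf jk) [LHS]mulr0.
Qed.

Lemma lfun_tensorE n m (T U : finType) (S : {set T}) (S' : {set U})
    (f : 'Hom(tensor C n S, tensor C m S')) x k :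
  f x k = \sum_j x j * f [ffun k => (k == j)%:R] k.
Proof.
rewrite {1}[x]tensorE linear_sum sum_ffunE; apply: eq_bigr => j _.
by rewrite linearZ ffunE.
Qed.

Lemma Gamma_delta S j (o : labelling D (out S)) :
  Gamma A [ffun o' => (o' == o)%:R] j = contract A j o.
Proof.
pose delta : tensor C D (out S) := [ffun o' => (o' == o)%:R].
have deltaE o' : delta o' = (o' == o)%:R by rewrite ffunE.
rewrite -/delta [LHS]ffunE (bigD1 o) //= big1 => [|o' /negPf oo'].
  by rewrite addr0 deltaE eqxx mulr1.
by rewrite deltaE oo' mulr0.
Qed.

Variable i0 : {ffun V -> 'I_d}.

(** For injective [S], a left inverse of [Gamma] reads off the coefficient at the open labels of
    [c]. [fibre_card] undoes the averaging in [region_amp]; the quotient accounts for summing over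
    labels on all of [V] instead of [S]. *)
Definition dual_amp S c i : C :=
  fibre_card S c * (#|{: labelling d S}|%:R / #|{: {ffun V -> 'I_d}}|%:R) *
  ((linfun (Gamma A (S := S)))^-1%VF [ffun j => (j == rs S i)%:R]) (rs (out S) c).

Lemma dual_amp_dep S c : depends_on S (dual_amp S c).
Proof. by move=> i i' /rsP/eqP ii'; rewrite /dual_amp ii'. Qed.

Lemma eq_dual_amp S c c' : {in out S, c =1 c'} -> dual_amp S c =1 dual_amp S c'.
Proof.
by move=> /rsP/eqP cc' i; rewrite /dual_amp cc' (eq_fibre_card cc').
Qed.

(** The left inverse undoes [Gamma] on the basis tensor at the open labels of [c'], and its
    coordinate at those of [c] is taken. *)
Lemma dual_ampP S c c' : injective_region A S ->
  \sum_i dual_amp S c i * region_amp S i c' = (rs (out S) c == rs (out S) c')%:R.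
Proof.
move=> injS; set L := (linfun (Gamma A (S := S)))^-1%VF.
have LK x : L (Gamma A x) = x.
  rewrite -[Gamma A x]lfunE; apply: lker0_lfunK; apply/lker0P.
  by move=> y z; rewrite !lfunE; apply: injS.
pose F j := fibre_card S c / fibre_card S c' *
   (L [ffun k => (k == j)%:R] (rs (out S) c) * contract A j (rs (out S) c')).
transitivity (\sum_j F j).
  apply: (mulfI (cfg_neq0 C i0)); rewrite -sum_rs mulr_sumr mulr_sumr.
  apply: eq_bigr => i _; rewrite /F contract_region_amp /dual_amp -/L.
  by field; rewrite (fibre_card_neq0 S c') (cfg_neq0 C i0).
rewrite /F -mulr_sumr; transitivity (fibre_card S c / fibre_card S c' *
    L (Gamma A [ffun o => (o == rs (out S) c')%:R]) (rs (out S) c)).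
  congr (_ * _); rewrite lfun_tensorE; apply: eq_bigr => j _.
  by rewrite Gamma_delta mulrC.
rewrite LK ffunE; case: eqP => [cc'|]; last by rewrite mulr0.
by rewrite (eq_fibre_card cc') mulr1 divff ?fibre_card_neq0.
Qed.

(* psi belongs to the image of Gamma_S (x) 1: it is a sum of products of an
   element of the image of Gamma_S and a function of the other sites. *)
Definition in_image S (psi : {ffun V -> 'I_d} -> C) : Prop :=
  exists (K : finType) (u : K -> {ffun E -> 'I_D})
      (Z : K -> {ffun V -> 'I_d} -> C),
    (forall k, depends_on (~: S) (Z k)) /\
    (forall i, psi i = \sum_k region_amp S i (u k) * Z k i).

(** Once the shared bonds are fixed, the amplitude of the union splits. The factor of [T] is
    absorbed into [Z], and the index gains the bond labels averaged over. *)
Lemma in_image_setU S T psi : [disjoint S & T] ->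
  in_image (S :|: T) psi -> in_image S psi.
Proof.
move=> dST [K [u [Z [dZ psiE]]]].
pose M := out S :&: out T.
exists (K * {ffun E -> 'I_D})%type; exists (fun p => mix M p.2 (u p.1)).
exists (fun p i => #|{: {ffun E -> 'I_D}}|%:R^-1 *
   (region_amp T i (mix M p.2 (u p.1)) * Z p.1 i)); split=> [[k x] | i] /=.
  move=> i i' ii'; congr (_ * (_ * _)).
    apply: region_amp_dep_site => v vT; apply: ii'.
    by rewrite inE (disjointFl dST vT).
  by apply: dZ => v; rewrite !inE negb_or => /andP[vS _]; apply: ii'; rewrite inE.
rewrite psiE -(pair_big xpredT xpredT (fun k x => region_amp S i (mix M x (u k)) *
  (#|{: {ffun E -> 'I_D}}|%:R^-1 * (region_amp T i (mix M x (u k)) * Z k i)))) /=.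
apply: eq_bigr => k _; rewrite region_amp_setU // /avg -mulrA mulr_suml mulr_sumr.
by apply: eq_bigr => x _; rewrite [RHS]mulrCA !mulrA.
Qed.

End Peps.

(** * Pairings with dual functionals *)

Section Pairing.
Variables (C : numClosedFieldType) (V E : finType) (ends : E -> {set V}).
Variables (d D : nat) (A : peps_tensors C ends d D).
Hypothesis ends_loopless : loopless ends.
Variables (i0 : {ffun V -> 'I_d}) (c0 : {ffun E -> 'I_D}).
Local Notation out := (outgoing ends).
Local Notation region_amp := (region_amp A).
Local Notation dual_amp := (dual_amp A).
Local Notation in_image := (in_image A).
Local Notation N := #|{: {ffun V -> 'I_d}}|%:R.
Implicit Types (S T : {set V}) (i : {ffun V -> 'I_d}) (c : {ffun E -> 'I_D}).

Lemma pairing_setU S T f g c : [disjoint S & T] ->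
  depends_on S f -> depends_on T g ->
  N * (\sum_i f i * g i * region_amp (S :|: T) i c) =
  avg (out S :&: out T)
    (fun b => (\sum_i f i * region_amp S i b) * (\sum_i g i * region_amp T i b)) c.
Proof.
move=> dST df dg; rewrite /avg.
under eq_bigr => i _ do rewrite region_amp_setU // /avg mulrCA mulr_sumr.
rewrite -mulr_sumr mulrCA exchange_big /= mulr_sumr; congr (_ * _).
apply: eq_bigr => b _; rewrite (@sum_mul_indep _ _ _ S).
- by congr (_ * _); apply: eq_bigr => i _; ring.
- exact: depends_onM df (@region_amp_dep_site _ _ _ _ _ _ A S _).
- apply: (@depends_onW _ _ _ T); first by rewrite subsets_disjoint setCK disjoint_sym.
  exact: depends_onM dg (@region_amp_dep_site _ _ _ _ _ _ A T _).
Qed.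

Lemma pairing_image S psi (K : finType) (u : K -> {ffun E -> 'I_D})
    (Z : K -> {ffun V -> 'I_d} -> C) f h :
  (forall k, depends_on (~: S) (Z k)) ->
  (forall i, psi i = \sum_k region_amp S i (u k) * Z k i) ->
  depends_on S f -> depends_on (~: S) h ->
  N * (\sum_i f i * (h i * psi i)) =
  \sum_k (\sum_i f i * region_amp S i (u k)) * (\sum_i h i * Z k i).
Proof.
move=> dZ psiE df dh.
under eq_bigr => i _ do rewrite psiE !mulr_sumr.
rewrite exchange_big mulr_sumr; apply: eq_bigr => k _.
rewrite (@sum_mul_indep _ _ _ S).
- by congr (_ * _); apply: eq_bigr => i _; ring.
- exact: depends_onM df (@region_amp_dep_site _ _ _ _ _ _ A S _).
- exact: depends_onM dh (dZ k).
Qed.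

(** Amplitudes of [S] depend only on open labels, so the terms of [psi] are grouped by these. By
    [dual_ampP] the total coefficient of a group is, up to [N], a pairing with a dual functional,
    hence zero. *)
Lemma dual_amp_complete S psi f h : injective_region A S -> in_image S psi ->
  depends_on S f -> depends_on (~: S) h ->
  (forall c, \sum_i dual_amp S c i * (h i * psi i) = 0) ->
  \sum_i f i * (h i * psi i) = 0.
Proof.
move=> injS [K [u [Z [dZ psiE]]]] df dh dual0.
apply: (mulfI (cfg_neq0 C i0)); rewrite mulr0 (pairing_image dZ psiE df dh).
rewrite (partition_big (fun k => rs (out S) (u k)) xpredT) //=.
apply: big1 => o _; case: (pickP (fun k => rs (out S) (u k) == o)) => [k0|]; last first.
  by move=> no; rewrite big_pred0.
move=> /eqP <-.
transitivity ((\sum_i f i * region_amp S i (u k0)) *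
    \sum_(k | rs (out S) (u k) == rs (out S) (u k0)) \sum_i h i * Z k i).
  rewrite mulr_sumr; apply: eq_bigr => k /rsP uk; congr (_ * _).
  apply: eq_bigr => i _; congr (_ * _).
  exact: (@region_amp_dep_edge _ _ _ _ _ _ A ends_loopless S i _ _ uk).
have := pairing_image dZ psiE (@dual_amp_dep _ _ _ _ _ _ A S (u k0)) dh.
rewrite dual0 mulr0 => sum0; rewrite (_ : \sum_(k | _) _ = 0) ?mulr0 // [RHS]sum0.
rewrite big_mkcond; apply: eq_bigr => k _.
by rewrite (dual_ampP ends_loopless i0) // eq_sym; case: eqP; rewrite ?mul1r ?mul0r.
Qed.

(** Induction replaces one dual functional at a time by an arbitrary function on its region; [h] is
    general because it carries the factors already replaced. *)
Lemma dual_amps_complete (Q : seq {set V}) psi : uniq Q ->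
  {in Q &, forall S T, S != T -> [disjoint S & T]} ->
  {in Q, forall S, injective_region A S} -> {in Q, forall S, in_image S psi} ->
  forall h, {in Q, forall S, depends_on (~: S) h} ->
  (forall y : {set V} -> {ffun E -> 'I_D},
     \sum_i (\prod_(S <- Q) dual_amp S (y S) i) * (h i * psi i) = 0) ->
  forall f : {set V} -> {ffun V -> 'I_d} -> C,
  {in Q, forall S, depends_on S (f S)} ->
  \sum_i (\prod_(S <- Q) f S i) * (h i * psi i) = 0.
Proof.
elim: Q => [|S Q IH] /=.
  move=> _ _ _ _ h _ h0 f _; rewrite -[RHS](h0 (fun=> c0)).
  by apply: eq_bigr => i _; rewrite !big_nil.
case/andP=> SQ uQ dQ injQ imQ h dh h0 f df.
have sQ T : T \in Q -> T \in S :: Q by rewrite inE orbC => ->.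
have SS : S \in S :: Q by rewrite mem_head.
have nS T : T \in Q -> T != S by apply: contraTneq => ->.
transitivity (\sum_i (\prod_(T <- Q) f T i) * ((f S i * h i) * psi i)).
  by apply: eq_bigr => i _; rewrite big_cons; ring.
apply: (IH uQ) => [T T' /sQ TQ /sQ T'Q|T /sQ|T /sQ|T TQ|y|T /sQ].
- exact: dQ.
- exact: injQ.
- exact: imQ.
- apply: depends_onM (dh _ (sQ _ TQ)); apply: depends_onW (df _ SS).
  by rewrite subsets_disjoint setCK dQ ?(sQ _ TQ) // eq_sym nS.
(* The dual functionals of the other regions do not see [S], so they join [h] as the part outside
   [S]. *)
- transitivity (\sum_i f S i * ((\prod_(T <- Q) dual_amp T (y T) i * h i) * psi i)).
    by apply: eq_bigr => i _; ring.
  apply: (@dual_amp_complete S).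
  + exact: injQ.
  + exact: imQ.
  + exact: df.
  + apply: depends_onM (dh _ SS) => i i' ii'; apply: eq_big_seq => T TQ.
    apply: (@dual_amp_dep _ _ _ _ _ _ A T (y T)) => v vT; apply: ii'.
    by rewrite inE (disjointFr (dQ T S (sQ _ TQ) SS (nS _ TQ)) vT).
  + move=> c; rewrite -[RHS](h0 (fun T => if T == S then c else y T)).
    apply: eq_bigr => i _; rewrite big_cons eqxx.
    rewrite [in RHS](eq_big_seq (fun T => dual_amp T (y T) i)) => [|T TQ].
      by move: (dual_amp S c i) => a; ring.
    by rewrite (negPf (nS T TQ)).
- exact: df.
Qed.

Definition agree S c c' : C := (rs (out S) c == rs (out S) c')%:R.

Lemma pairing_dual_setU S T c c' b : [disjoint S & T] ->
  injective_region A S -> injective_region A T ->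
  N * (\sum_i dual_amp S c i * dual_amp T c' i * region_amp (S :|: T) i b) =
  avg (out S :&: out T) (fun b => agree S c b * agree T c' b) b.
Proof.
move=> dST injS injT; rewrite pairing_setU //; try exact: dual_amp_dep.
by apply: eq_avg => x; rewrite !(dual_ampP ends_loopless i0).
Qed.

Lemma avg_agree_neq S T c c' b e : e \in out S -> e \in out T -> c e != c' e ->
  avg (out S :&: out T) (fun b => agree S c b * agree T c' b) b = 0.
Proof.
move=> eS eT cc'; rewrite /avg big1 ?mulr0 // => x _; rewrite /agree.
case: rsP => [/(_ e eS) cx|]; last by rewrite mul0r.
case: rsP => [/(_ e eT) c'x|]; last by rewrite mulr0.
by case/eqP: cc'; rewrite cx c'x.
Qed.

(** Transposing [c e] and [c' e] at every edge permutes the configurations averaged over and turns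
    agreement with [c] into agreement with [c']; off the shared edges the two coincide. *)
Lemma avg_agree_change S T c c' b :
  {in ~: (out S :&: out T), c =1 c'} ->
  avg (out S :&: out T) (fun b => agree S c b * agree T c b) b =
  avg (out S :&: out T) (fun b => agree S c' b * agree T c' b) b.
Proof.
set M := _ :&: _ => cc'; congr (_ * _).
pose s (x : {ffun E -> 'I_D}) : {ffun E -> 'I_D} :=
  [ffun e => tperm (c e) (c' e) (x e)].
have s_inj : injective s.
  by move=> x y /ffunP xy; apply/ffunP=> e; have := xy e; rewrite !ffunE => /perm_inj.
have sE U x : rs U (mix M (s x) b) == rs U c = (rs U (mix M x b) == rs U c').
  apply/rsP/rsP => H e eU; have := H e eU; rewrite !ffunE; case: ifPn => eM.
  - by move/(canRL (tpermK _ _)); rewrite tpermL.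
  - by move->; apply: cc'; rewrite inE.
  - by move->; rewrite tpermR.
  - by move->; rewrite cc' // inE.
rewrite (reindex_inj s_inj); apply: eq_bigr => x _.
by rewrite /agree ![rs _ c == _]eq_sym !sE ![_ == rs _ c']eq_sym.
Qed.

End Pairing.

(** * Coverings by injective regions *)

Lemma disjoint_setU (T : finType) (A B D : {set T}) :
  [disjoint A & D] -> [disjoint B & D] -> [disjoint A :|: B & D].
Proof. by rewrite -!setI_eq0 setIUl setU_eq0 => -> ->. Qed.

Section Covering.
Variables (C : numClosedFieldType) (V E : finType) (ends : E -> {set V}).
Variables (d D : nat) (A : peps_tensors C ends d D).
Hypothesis ends_loopless : loopless ends.
Variables (i0 : {ffun V -> 'I_d}) (c0 : {ffun E -> 'I_D}).
Variable P : {set {set V}}.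
Hypothesis P_partition : partition P [set: V].
Hypothesis P_injective : {in P, forall S, injective_region A S}.
Local Notation out := (outgoing ends).
Local Notation region_amp := (region_amp A).
Local Notation dual_amp := (dual_amp A).
Local Notation in_image := (in_image A).
Local Notation agree := (agree C ends).
Local Notation N := #|{: {ffun V -> 'I_d}}|%:R.
Implicit Types (S T : {set V}) (i : {ffun V -> 'I_d}) (c : {ffun E -> 'I_D}).
Implicit Types (psi : {ffun V -> 'I_d} -> C) (y : {set V} -> {ffun E -> 'I_D}).

Lemma regions_disjoint : {in P &, forall S T, S != T -> [disjoint S & T]}.
Proof. by case/and3P: P_partition => _ /trivIsetP. Qed.

Lemma region_of v : exists2 S, S \in P & v \in S.
Proof.
case/and3P: P_partition => /eqP coverP _ _.
have : v \in cover P by rewrite coverP inE.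
by case/bigcupP=> S; exists S.
Qed.

Definition amplitude psi y : C :=
  \sum_i (\prod_(S in P) dual_amp S (y S) i) * psi i.

(** The indicator of a configuration is the product of the indicators of its restrictions to the
    regions, so [dual_amps_complete] recovers each value of [psi]. *)
Lemma amplitude_eq0 psi : {in P, forall S, in_image S psi} ->
  (forall y, amplitude psi y = 0) -> forall i, psi i = 0.
Proof.
move=> imP amp0 i1.
pose f S i : C := (rs S i == rs S i1)%:R.
have fE i : \prod_(S in P) f S i = (i == i1)%:R.
  case: eqP => [->|ii1]; first by rewrite big1 // => S _; rewrite /f eqxx.
  apply/eqP; rewrite prodf_seq_eq0 /=; apply/hasP.
  have [v iv] : exists v, i v != i1 v.
    apply/existsP; rewrite -negb_forall; apply/negP => /forallP ii.
    by apply: ii1; apply/ffunP=> v; apply/eqP/ii.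
  have [S SP vS] := region_of v; exists S; first by rewrite mem_index_enum.
  by rewrite SP /f; case: rsP => [/(_ v vS)/eqP|]; rewrite ?(negPf iv) //= eqxx.
have : \sum_i (\prod_(S <- enum P) f S i) * (1 * psi i) = 0.
  apply: (@dual_amps_complete _ _ _ _ _ _ A ends_loopless i0 c0 (enum P) psi
    _ _ _ _ (fun=> 1)) => //.
  - exact: enum_uniq.
  - by move=> S T; rewrite !mem_enum; apply: regions_disjoint.
  - by move=> S; rewrite mem_enum; apply: P_injective.
  - by move=> S; rewrite mem_enum; apply: imP.
  - move=> y; rewrite -[RHS](amp0 y); apply: eq_bigr => i _.
    by rewrite big_enum mul1r.
  - by move=> S _ i i' /rsP/eqP ii'; rewrite /f ii'.
rewrite (bigD1 i1) //= big_enum fE eqxx !mul1r big1 ?addr0 // => i ii1.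
by rewrite big_enum fE (negPf ii1) mul0r.
Qed.

Lemma eq_amplitude psi y y' : {in P, forall S, {in out S, y S =1 y' S}} ->
  amplitude psi y = amplitude psi y'.
Proof.
move=> yy'; apply: eq_bigr => i _; congr (_ * _); apply: eq_bigr => S SP.
exact: eq_dual_amp (yy' S SP) i.
Qed.

(** The labels of [S] and [T] enter only through agreement on bonds, those of other regions only
    through [w]. One [N] comes from splitting off the pair, the other from separating [S] and
    [T]. *)
Lemma amplitude_pair S T psi : S \in P -> T \in P -> S != T ->
  in_image (S :|: T) psi ->
  exists (K : finType) (u : K -> {ffun E -> 'I_D})
      (w : K -> ({set V} -> {ffun E -> 'I_D}) -> C),
  [/\ forall k y y', {in P :\ S :\ T, forall U, {in out U, y U =1 y' U}} ->
        w k y = w k y'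
    & forall y, N * (N * amplitude psi y) = \sum_k
        avg (out S :&: out T) (fun b => agree S (y S) b * agree T (y T) b) (u k)
        * w k y].
Proof.
move=> SP TP ST [K [u [Z [dZ psiE]]]]; exists K; exists u.
pose r y i := \prod_(U in P :\ S :\ T) dual_amp U (y U) i.
exists (fun k y => \sum_i r y i * Z k i); split=> [k y y' yy' | y].
  apply: eq_bigr => i _; congr (_ * _); apply: eq_bigr => U UP.
  exact: eq_dual_amp (yy' U UP) i.
have dST := regions_disjoint SP TP ST.
have TPS : T \in P :\ S by rewrite !inE eq_sym ST.
have -> : amplitude psi y = \sum_i
    (dual_amp S (y S) i * dual_amp T (y T) i) * (r y i * psi i).
  apply: eq_bigr => i _; rewrite (big_setD1 S SP) (big_setD1 T TPS) /= -/(r y i).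
  by move: (dual_amp S _ i) (dual_amp T _ i) => a b; ring.
rewrite (pairing_image dZ psiE) //.
- rewrite mulr_sumr; apply: eq_bigr => k _; rewrite mulrA; congr (_ * _).
  by apply: pairing_dual_setU => //; apply: P_injective.
- apply: depends_onM.
    by apply: depends_onW (subsetUl S T) _; apply: dual_amp_dep.
  by apply: depends_onW (subsetUr S T) _; apply: dual_amp_dep.
- apply: depends_on_prod => U; rewrite !inE => /and3P[UT US UP].
  apply: (@depends_onW _ _ _ U); last exact: dual_amp_dep.
  rewrite subsets_disjoint setCK disjoint_sym disjoint_setU //.
    by apply: regions_disjoint; rewrite // eq_sym.
  by apply: regions_disjoint; rewrite // eq_sym.
Qed.

Lemma amplitude_neq S T psi y e : S \in P -> T \in P -> S != T ->
  in_image (S :|: T) psi -> e \in out S -> e \in out T -> y S e != y T e ->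
  amplitude psi y = 0.
Proof.
move=> SP TP ST imST eS eT yST.
have [K [u [w [_ ampE]]]] := amplitude_pair SP TP ST imST.
apply: (mulfI (cfg_neq0 C i0)); apply: (mulfI (cfg_neq0 C i0)).
rewrite ampE !mulr0 big1 // => k _.
by rewrite (avg_agree_neq _ _ eS eT yST) mul0r.
Qed.

(** The second endpoint of [e] lies in some [T]; then [S] and [T] use up both endpoints. *)
Lemma outgoing_other_region S e : S \in P -> e \in out S ->
  exists T, [/\ T \in P, S != T, e \in out T
    & {in P :\ S :\ T, forall U, e \notin out U}].
Proof.
move=> SP; rewrite inE => /eqP eS.
have [v ve vS] : exists2 v, v \in ends e & v \notin S.
  apply/subsetPn; apply: contra_eqN eS => /setIidPl ->.
  by rewrite ends_loopless.
have [T TP vT] := region_of v.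
have ST : S != T by apply: contraNneq vS => ->.
have dST := regions_disjoint SP TP ST.
have eT : #|ends e :&: T| = 1%N.
  have := card_ends_setU_le e ends_loopless dST; rewrite eS add1n ltnS => leT.
  by apply/eqP; rewrite eqn_leq leT; apply/card_gt0P; exists v; rewrite inE ve.
exists T; split; rewrite ?inE ?eT // => U; rewrite !inE => /and3P[UT US UP].
have dU : [disjoint S :|: T & U].
  by apply: disjoint_setU; apply: regions_disjoint; rewrite // eq_sym.
have := card_ends_setU_le e ends_loopless dU.
by rewrite card_ends_setU // eS eT; case: #|_|.
Qed.

Section PairImages.
Variable psi : {ffun V -> 'I_d} -> C.
Hypothesis psi_pairs : {in P &, forall S T, S != T -> joined ends S T ->
  in_image (S :|: T) psi}.

(** Either [e] leaves no region and no dual functional sees it, or it joins exactly two: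
    [avg_agree_change] treats these, and [w] ignores [e]. *)
Lemma amplitude_change1 c c' e : {in [set~ e], c =1 c'} ->
  amplitude psi (fun=> c) = amplitude psi (fun=> c').
Proof.
move=> cc'; have cc'U U : e \notin out U -> {in out U, c =1 c'}.
  by move=> eU e' e'U; apply: cc'; rewrite !inE; apply: contraNneq eU => <-.
case: (pickP (fun S => (S \in P) && (e \in out S))) => [S /andP[SP eS]|no];
    last first.
  by apply: eq_amplitude => U UP; apply: cc'U; have := no U; rewrite UP => /= ->.
have [T [TP ST eT eU]] := outgoing_other_region SP eS.
have jST := outgoing_setI_joined ends_loopless (regions_disjoint SP TP ST) eS eT.
have [K [u [w [wE ampE]]]] := amplitude_pair SP TP ST (psi_pairs SP TP ST jST).
apply: (mulfI (cfg_neq0 C i0)); apply: (mulfI (cfg_neq0 C i0)).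
rewrite !ampE; apply: eq_bigr => k _.
rewrite (wE _ _ (fun=> c')) => [|U UP]; last exact: cc'U (eU U UP).
congr (_ * _); apply: avg_agree_change => e'; rewrite inE => e'M; apply: cc'.
by rewrite !inE; apply: contraNneq e'M => ->; rewrite inE eS eT.
Qed.

Lemma amplitude_const c c' :
  amplitude psi (fun=> c) = amplitude psi (fun=> c').
Proof.
(* The labels are changed one edge at a time. *)
suff amp_mix (s : seq E) :
    amplitude psi (fun=> mix [set e in s] c' c) = amplitude psi (fun=> c).
  rewrite -(amp_mix (enum E)) (_ : mix _ _ _ = c') //.
  by apply/ffunP=> e; rewrite ffunE inE mem_enum.
elim: s => [|e s <-].
  rewrite (_ : mix _ _ _ = c) //.
  by apply/ffunP=> e; rewrite ffunE inE.
apply: (@amplitude_change1 _ _ e) => e'; rewrite !inE => /negPf e'e.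
by rewrite !ffunE !inE e'e.
Qed.

Lemma amplitude_inj : {in P, forall S, in_image S psi} ->
  amplitude psi (fun=> c0) = 0 -> forall i, psi i = 0.
Proof.
move=> imP amp0; apply: amplitude_eq0 => // y.
(* An element of [bad] is an edge on which two regions carry different labels, which forces the
   amplitude to vanish. *)
pose bad p := [&& p.1.1 \in P, p.1.2 \in P, p.1.1 != p.1.2, p.2 \in out p.1.1,
  p.2 \in out p.1.2 & y p.1.1 p.2 != y p.1.2 p.2].
case: (pickP bad) => [[[S T] e] /and5P[/= SP TP ST eS /andP[eT yST]]|good].
  apply: (amplitude_neq SP TP ST _ eS eT yST); apply: psi_pairs => //.
  exact: outgoing_setI_joined ends_loopless (regions_disjoint SP TP ST) eS eT.
(* Otherwise the labels glue to one configuration; [c0] fills the edges that leave no region. *)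
pose c : {ffun E -> 'I_D} :=
  [ffun e => if [pick U in P | e \in out U] is Some U then y U e else c0 e].
rewrite -amp0 -(amplitude_const c); apply: eq_amplitude => S SP e eS.
rewrite ffunE; case: pickP => [T /andP[TP eT]|/(_ S)]; last by rewrite SP eS.
apply/eqP; have := good (S, T, e); rewrite /bad /= SP TP eS eT /=.
by case: eqVneq => [->|ST /=]; [rewrite eqxx | case: eqP].
Qed.

End PairImages.

(* Unlike a nonzero pairing with the amplitude of S at c0 alone, this is stable
   under disjoint unions: all terms of the average over bonds are nonnegative. *)
Definition positive_dual S : Prop := exists f, [/\ depends_on S f,
  forall c, 0 <= \sum_i f i * region_amp S i c
  & 0 < \sum_i f i * region_amp S i c0].

Lemma positive_dual0 : positive_dual set0.
Proof.
have amp0 i c : region_amp set0 i c = 1.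
  rewrite -[RHS](avg_cst (internal ends set0) 1 c); apply: eq_avg => x.
  by rewrite /site_prod big_set0.
exists (fun=> 1); split=> // [c|].
  by apply: sumr_ge0 => i _; rewrite amp0 mulr1 ler01.
under eq_bigr => i _ do rewrite amp0 mulr1.
by rewrite sumr_const ltr0n; apply/card_gt0P; exists i0.
Qed.

Lemma positive_dualU S T : [disjoint S & T] ->
  positive_dual S -> positive_dual T -> positive_dual (S :|: T).
Proof.
move=> dST [f [df f_ge0 f_gt0]] [g [dg g_ge0 g_gt0]].
(* The factor [N] is the one in [pairing_setU]. *)
exists (fun i => N * (f i * g i)).
have fgE c : \sum_i N * (f i * g i) * region_amp (S :|: T) i c =
    avg (out S :&: out T) (fun b => (\sum_i f i * region_amp S i b) *
      (\sum_i g i * region_amp T i b)) c.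
  rewrite -pairing_setU // mulr_sumr; apply: eq_bigr => i _;
  by rewrite [RHS]mulrA.
have N_gt0 : 0 < #|{: {ffun E -> 'I_D}}|%:R^-1 :> C.
  by rewrite invr_gt0 ltr0n; apply/card_gt0P; exists c0.
split=> [i i' ii'|c|].
- by congr (_ * (_ * _)); [apply: df | apply: dg] => v vS; apply: ii';
    rewrite inE vS ?orbT.
- rewrite fgE; apply: mulr_ge0; first exact: ltW.
  by apply: sumr_ge0 => x _; apply: mulr_ge0.
(* In the average around [c0], the term indexed by [c0] is evaluated at [c0] itself, hence is
   strictly positive. *)
- rewrite fgE; apply: mulr_gt0 => //; rewrite (bigD1 c0) //=.
  apply: ltr_pwDl; last by apply: sumr_ge0 => x _; apply: mulr_ge0.
  rewrite (_ : mix _ _ _ = c0) ?mulr_gt0 //.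
  by apply/ffunP=> e; rewrite ffunE if_same.
Qed.

(** Regions are merged by [positive_dualU]; for a single one the dual functional at [c0] serves, its
    pairings being 0 or 1. *)
Lemma region_amp_setT_neq0 : exists i, region_amp setT i c0 != 0.
Proof.
suff [f [_ _]] : positive_dual setT.
  move=> f_gt0; apply/existsP; apply: contraTT f_gt0; rewrite negb_exists.
  move=> /forallP amp0; rewrite big1 ?ltxx // => i _.
  by have := amp0 i; rewrite negbK => /eqP->; rewrite mulr0.
have -> : setT = \bigcup_(S <- enum P) S.
  by rewrite big_enum; case/and3P: P_partition => /eqP <-.
have : {subset enum P <= P} by move=> S; rewrite mem_enum.
elim: (enum P) (enum_uniq P) => [|S Q IH] /=.
  by rewrite big_nil => *; apply: positive_dual0.
case/andP=> SQ uQ QP; rewrite big_cons; apply: positive_dualU.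
- rewrite bigcup_seq; apply: bigcup_disjoint => T TQ.
  apply: regions_disjoint; rewrite ?QP ?mem_head ?inE ?TQ ?orbT //.
  by apply: contraNneq SQ => ->.
- have SP : S \in P by rewrite QP ?mem_head.
  exists (dual_amp S c0); split=> [|c|]; first exact: dual_amp_dep.
    by rewrite (dual_ampP ends_loopless i0 _ _ (P_injective SP)) ler0n.
  by rewrite (dual_ampP ends_loopless i0 _ _ (P_injective SP)) eqxx ltr01.
- by apply: IH => // T TQ; rewrite QP // inE TQ orbT.
Qed.

End Covering.

(** * The parent Hamiltonian *)

Section Gram.
Variables (C : numClosedFieldType) (T : finType) (n : nat) (S : {set T}).
Variable f : 'End(tensor C n S).
Implicit Types x y : tensor C n S.

Lemma inner_eq0 x : inner x x = 0 -> x = 0.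
Proof.
move=> /eqP; rewrite psumr_eq0 => [/allP x0|i _]; last by rewrite mulrC mul_conjC_ge0.
apply/ffunP=> i; have := x0 i (mem_index_enum i).
by rewrite mulrC mul_conjC_eq0 ffunE => /eqP.
Qed.

Lemma inner_ge0 x : 0 <= inner x x.
Proof. by apply: sumr_ge0 => i _; rewrite mulrC mul_conjC_ge0. Qed.

Lemma innerC x y : (inner x y)^* = inner y x.
Proof.
by rewrite rmorph_sum; apply: eq_bigr => i _; rewrite rmorphM /= conjCK mulrC.
Qed.

(* The composition of the adjoint of f with f. *)
Definition gram_fun x : tensor C n S :=
  [ffun i => inner (f [ffun k => (k == i)%:R]) (f x)].

Lemma gram_fun_is_linear : linear gram_fun.
Proof.
move=> a x y; apply/ffunP=> i; rewrite !ffunE linearP /inner scaler_sumr -big_split.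
by apply: eq_bigr => k _; rewrite !ffunE mulrDr /GRing.scale /= mulrCA.
Qed.

HB.instance Definition _ :=
  GRing.isLinear.Build C (tensor C n S) (tensor C n S) _ gram_fun gram_fun_is_linear.

Definition gram : 'End(tensor C n S) := linfun gram_fun.

Lemma inner_gram x y : inner x (gram y) = inner (f x) (f y).
Proof.
rewrite /inner lfunE /=.
under [RHS]eq_bigr => k _ do rewrite lfun_tensorE rmorph_sum mulr_suml.
rewrite exchange_big; apply: eq_bigr => i _; rewrite ffunE mulr_sumr.
by apply: eq_bigr => k _; rewrite rmorphM mulrA.
Qed.

Lemma psd_gram : psd gram.
Proof.
split=> [x y|x]; last by rewrite inner_gram inner_ge0.
by rewrite -[RHS]innerC !inner_gram innerC.
Qed.

Lemma inner_gram_eq0 x : inner x (gram x) = 0 -> f x = 0.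
Proof. by rewrite inner_gram; apply: inner_eq0. Qed.

Lemma gram_eq0 x : f x = 0 -> gram x = 0.
Proof.
move=> fx; apply/ffunP=> i; rewrite lfunE !ffunE fx /inner big1 // => k _.
by rewrite [X in _ * X]ffunE mulr0.
Qed.

End Gram.

(** * Vectors with the sites outside a region frozen *)

Section Slices.
Variables (C : numClosedFieldType) (V : finType) (d : nat).
Implicit Types (S : {set V}) (psi : tensor C d [set: V]) (x : {ffun V -> 'I_d}).

Definition slice S psi i : tensor C d S := [ffun j => psi (override j i)].

Lemma eq_slice S psi x x' : {in ~: S, x =1 x'} ->
  slice S psi (rs setT x) = slice S psi (rs setT x').
Proof.
move=> xx'; apply/ffunP=> j; rewrite !ffunE !override_rs; congr (psi (rs _ _)).
apply/ffunP=> v; rewrite !ffunE; case: insubP => // vS.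
by apply: xx'; rewrite inE.
Qed.

Lemma slice_rs S psi x : slice S psi (rs setT x) (rs S x) = psi (rs setT x).
Proof. by rewrite ffunE override_rs patch_id. Qed.

Lemma ampliate_rs S (h : 'End(tensor C d S)) psi x :
  ampliate h psi (rs setT x) = h (slice S psi (rs setT x)) (rs S x).
Proof. by rewrite ampliateE restrict_rs. Qed.

(** An ampliated operator is block diagonal over the labels outside [S]; the sum over [x] visits
    each block once per labelling of [S]. *)
Lemma inner_ampliate S (h : 'End(tensor C d S)) psi :
  #|{: labelling d S}|%:R * inner psi (ampliate h psi) =
  \sum_(x : {ffun V -> 'I_d})
     inner (slice S psi (rs setT x)) (h (slice S psi (rs setT x))).
Proof.
rewrite /inner (reindex _ (onW_bij _ (rs_bij V d))) /= -sum_patch.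
apply: eq_bigr => x _; apply: eq_bigr => j _.
rewrite ampliate_rs rs_patch ffunE override_rs; congr (_ * h _ _).
apply: eq_slice => v; rewrite inE; exact: patch_off.
Qed.

Lemma tensor_setT_ext psi psi' :
  (forall x, psi (rs setT x) = psi' (rs setT x)) -> psi = psi'.
Proof.
have [g _ gK] := rs_bij V d.
by move=> eq_psi; apply/ffunP=> i; rewrite -(gK i).
Qed.

End Slices.

(** * The interaction terms and the kernel of their sum *)

Section ParentHamiltonian.
Variables (C : numClosedFieldType) (V E : finType) (ends : E -> {set V}).
Variables (d D : nat) (A : peps_tensors C ends d D).
Hypothesis ends_loopless : loopless ends.
Variables (i0 : {ffun V -> 'I_d}) (c0 : {ffun E -> 'I_D}).
Local Notation out := (outgoing ends).
Local Notation Gamma_lfun S := (linfun (Gamma A (S := S))).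
Implicit Types (S T : {set V}) (psi : tensor C d [set: V]).

(** [projv] need not be an orthogonal projection; [gram] makes the term positive and keeps the
    kernel. *)
Definition parent_term S : 'End(tensor C d S) :=
  gram (\1 - projv (limg (Gamma_lfun S)))%VF.

Lemma parent_term_eq0 S x : x \in limg (Gamma_lfun S) -> parent_term S x = 0.
Proof.
move=> xW; apply: gram_eq0.
by rewrite !lfunE /= !lfunE /= projv_id // subrr.
Qed.

Lemma inner_parent_term S x :
  inner x (parent_term S x) = 0 -> x \in limg (Gamma_lfun S).
Proof.
move=> /inner_gram_eq0; rewrite !lfunE /= !lfunE /= => /eqP.
by rewrite subr_eq0 => /eqP ->; apply: memv_proj.
Qed.

(** A preimage of each slice is expanded over open labels; its coefficients ignore the labels on [S]
    because the slices do. [c0] merely extends open labels to all edges. *)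
Lemma in_image_slices S psi :
  (forall x, slice S psi (rs setT x) \in limg (Gamma_lfun S)) ->
  in_image A S (fun x => psi (rs setT x)).
Proof.
move=> imS; pose X x := ((Gamma_lfun S)^-1)%VF (slice S psi (rs setT x)).
exists (labelling D (out S)); exists (fun o => patch o c0).
exists (fun o x => fibre_card C ends S (patch o c0) * X x o); split=> [o x x' xx'|x].
  by rewrite /X (eq_slice _ xx').
rewrite -(slice_rs S) -(limg_lfunVK (imS x)) lfunE /= ffunE.
apply: eq_bigr => o _; rewrite -[in LHS](rs_patch o c0).
rewrite contract_region_amp // rs_patch -/(X x) mulrA; congr (_ * _).
exact: mulrC.
Qed.

Lemma slices_in_image S psi : in_image A S (fun x => psi (rs setT x)) ->
  forall x, slice S psi (rs setT x) \in limg (Gamma_lfun S).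
Proof.
move=> [K [u [Z [dZ psiE]]]] x.
have -> : slice S psi (rs setT x) = \sum_k
    ((fibre_card C ends S (u k))^-1 * Z k x) *:
    Gamma_lfun S [ffun o => (o == rs (out S) (u k))%:R].
  apply/ffunP=> j; rewrite ffunE override_rs psiE sum_ffunE.
  apply: eq_bigr => k _; rewrite ffunE lfunE /= Gamma_delta.
  rewrite -[j in RHS](rs_patch j x) contract_region_amp //.
  rewrite (dZ k (patch j x) x) => [|v]; last by rewrite inE; apply: patch_off.
  rewrite /GRing.scale /= mulrACA mulrA mulVf ?fibre_card_neq0 // mul1r mulrC.
  by rewrite ?mul1r.
by apply: memv_suml => k _; apply: memvZ; apply: memv_img; apply: memvf.
Qed.

Lemma peps_rs x : peps A (rs setT x) =
  fibre_card C ends setT c0 * region_amp A setT x c0.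
Proof.
rewrite -contract_region_amp // /peps ffunE (big_pred1 (rs (out setT) c0)) => [|o].
  by rewrite -[RHS]mulr1; congr (_ * _); rewrite ffunE.
apply/esym/eqP/ffunP=> -[e eT]; exfalso.
by rewrite outgoing_setT ?inE in eT.
Qed.

(** Up to a scalar the PEPS is the amplitude of [V], which is split into [S] and its complement. *)
Lemma in_image_peps S : in_image A S (fun x => peps A (rs setT x)).
Proof.
apply: (@in_image_setU _ _ _ _ _ _ A ends_loopless S (~: S)).
  by rewrite -setI_eq0 setICr.
rewrite setUCr; exists unit; exists (fun=> c0).
exists (fun=> fun=> fibre_card C ends setT c0); split=> // x.
by rewrite big_const card_unit /= addr0 peps_rs mulrC.
Qed.

Lemma ampliate_parent_term_peps S : ampliate (parent_term S) (peps A) = 0.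
Proof.
apply: tensor_setT_ext => x; rewrite ampliate_rs parent_term_eq0 ?ffunE //.
exact: slices_in_image (in_image_peps S) x.
Qed.

Variable P : {set {set V}}.
Hypothesis P_covering : injective_covering A P.
Hypothesis graph_connected : connected_in ends [set: V].
Hypothesis P_gt1 : (1 < #|P|)%N.

Let P_partition : partition P setT := P_covering.1.
Let P_injective : {in P, forall S, injective_region A S}.
Proof. by move=> S /(P_covering.2) []. Qed.

(** A path from [S] to another region exists by connectedness, and its first edge leaving [S]
    reaches a neighbour. *)
Lemma has_neighbour S : S \in P ->
  exists T, [/\ T \in P, S != T & joined ends S T].
Proof.
move=> SP; have [T0 T0P T0S] : exists2 T, T \in P & T != S.
  have : (0 < #|P :\ S|)%N by move: P_gt1; rewrite (cardsD1 S P) SP.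
  by case/card_gt0P=> T; rewrite !inE => /andP[TS TP]; exists T.
case/and3P: (P_partition) => _ _ P0.
have ne U : U \in P -> exists v, v \in U.
  by move=> UP; apply/set0Pn; apply: contraNneq P0 => <-.
have [[s sS] [t tT]] := (ne _ SP, ne _ T0P).
have tS : t \notin S.
  by rewrite (disjointFr (regions_disjoint P_partition T0P SP T0S) tT).
have [u [v [uS vS uv]]] :
    exists u v, [/\ u \in S, v \notin S & adjacent ends u v].
  have /connectP[p sp tE] := graph_connected (in_setT s) (in_setT t).
  move: tS; rewrite tE.
  elim: p s sS sp {tE} => [|v p IH] u uS /=; first by rewrite uS.
  rewrite !inE => /andP[uv vp] lastS.
  by have [vS|vS] := boolP (v \in S); [exact: IH vS vp lastS | exists u, v].
have [T TP vT] := region_of P_partition v.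
exists T; split=> //; first by apply: contraNneq vS => ->.
by apply/existsP; exists u; rewrite uS; apply/existsP; exists v; rewrite vT.
Qed.

Definition parent_hamiltonian :=
  hamiltonian ends P (fun p => parent_term (cover p)).

Lemma cover_set2 S T : cover [set S; T] = S :|: T.
Proof. by rewrite /cover bigcup_setU !big_set1. Qed.

(** The expectation of the Hamiltonian in [psi] is a sum of nonnegative numbers, over pairs and then
    over slices, so each of them vanishes. *)
Lemma ker_parent_hamiltonian psi : parent_hamiltonian psi = 0 ->
  {in P &, forall S T, S != T -> joined ends S T ->
    in_image A (S :|: T) (fun x => psi (rs setT x))}.
Proof.
move=> H0 S T SP TP ST jST.
have lab_gt0 (U : {set V}) : 0 < #|{: labelling d U}|%:R :> C.
  by rewrite ltr0n; apply/card_gt0P; exists (rs U i0).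
have term_ge0 U x :
    0 <= inner (slice U psi (rs setT x))
           (parent_term U (slice U psi (rs setT x))).
  exact: (psd_gram _).2.
have ampl_ge0 U : 0 <= inner psi (ampliate (parent_term U) psi).
  by rewrite -(pmulr_rge0 _ (lab_gt0 U)) inner_ampliate sumr_ge0.
have : inner psi (parent_hamiltonian psi) = 0.
  by rewrite H0 /inner big1 // => i _; rewrite ffunE mulr0.
have -> : inner psi (parent_hamiltonian psi) =
    \sum_(p in neighbour_pairs ends P)
      inner psi (ampliate (parent_term (cover p)) psi).
  rewrite /inner exchange_big; apply: eq_bigr => i _.
  by rewrite /parent_hamiltonian /hamiltonian sum_lfunE sum_ffunE mulr_sumr.
move/eqP; rewrite psumr_eq0 => [/allP p0|p _]; last exact: ampl_ge0.
rewrite -cover_set2; have := p0 [set S; T] (mem_index_enum _).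
have -> /= : [set S; T] \in neighbour_pairs ends P.
  by apply/imset2P; exists S T => //; rewrite inE TP ST jST.
move/eqP => inner0; apply: in_image_slices => x; apply: inner_parent_term.
have := inner_ampliate (parent_term (cover [set S; T])) psi.
rewrite inner0 mulr0 => /esym/eqP; rewrite psumr_eq0 => [/allP/(_ x)|y _].
  by rewrite mem_index_enum => /(_ isT)/eqP.
exact: term_ge0.
Qed.

Lemma peps_neq0 : peps A != 0.
Proof.
have [x ampx] := region_amp_setT_neq0 ends_loopless i0 c0 P_partition P_injective.
apply: contra_neq ampx => /ffunP/(_ (rs setT x)); rewrite peps_rs ffunE => /eqP.
by rewrite mulf_eq0 (negPf (fibre_card_neq0 _ _ _ _)) => /eqP.
Qed.

(** This bounds the dimension of the kernel by one. Each region has a neighbour, so the pair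
    conditions give the single-region ones that [amplitude_inj] requires. *)
Lemma eq0_parent_hamiltonian psi : parent_hamiltonian psi = 0 ->
  amplitude A P (fun x => psi (rs setT x)) (fun=> c0) = 0 -> psi = 0.
Proof.
move=> H0 amp0; apply: tensor_setT_ext => x; rewrite [RHS]ffunE.
have pairs := ker_parent_hamiltonian H0.
apply: (@amplitude_inj _ _ _ _ _ _ A ends_loopless i0 c0 P P_partition P_injective
  (fun x => psi (rs setT x)) pairs _ amp0 x).
move=> S SP; have [T [TP ST jST]] := has_neighbour SP.
apply: (@in_image_setU _ _ _ _ _ _ A ends_loopless S T); last exact: pairs.
exact: regions_disjoint P_partition _ _ _ _ _.
Qed.

Lemma parent_hamiltonian_peps : parent_hamiltonian (peps A) = 0.
Proof.
rewrite /parent_hamiltonian /hamiltonian sum_lfunE big1 // => p _.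
exact: ampliate_parent_term_peps.
Qed.

Lemma lker_parent_hamiltonian : lker parent_hamiltonian = <[peps A]>%VS.
Proof.
apply/eqP; rewrite eqEsubv; apply/andP; split; last first.
  by rewrite -memvE memv_ker parent_hamiltonian_peps.
apply/subvP=> psi; rewrite memv_ker => /eqP H0.
pose amp (phi : tensor C d setT) :=
  amplitude A P (fun x => phi (rs setT x)) (fun=> c0).
have amp_neq0 : amp (peps A) != 0.
  apply: contra_neq peps_neq0; apply: eq0_parent_hamiltonian.
  exact: parent_hamiltonian_peps.
(* This coefficient makes the amplitude of the difference vanish at [c0]. *)
apply/vlineP; exists (amp psi / amp (peps A)).
apply/eqP; rewrite -subr_eq0; apply/eqP; apply: eq0_parent_hamiltonian.
  by rewrite linearB linearZ /= H0 parent_hamiltonian_peps scaler0 subr0.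
pose k := amp psi / amp (peps A); rewrite -/k.
transitivity (amp psi - k * amp (peps A)); last by rewrite divfK ?subrr.
rewrite /amp /amplitude mulr_sumr -sumrB; apply: eq_bigr => x _.
rewrite !ffunE /GRing.scale /=; ring.
Qed.

End ParentHamiltonian.

Theorem theorem3 (R : realType) (V E : finType) (ends : E -> {set V})
    (d D : nat) (A : peps_tensors R[i] ends d D) (P : {set {set V}})
    (ends_loopless : loopless ends) (d_gt0 : (0 < d)%N) (D_gt0 : (0 < D)%N)
    (graph_connected : connected_in ends [set: V])
    (P_covering : injective_covering A P) (P_gt1 : (1 < #|P|)%N) :
  exists h : forall p : {set {set V}}, 'End(tensor R[i] d (cover p)),
    [/\ {in neighbour_pairs ends P, forall p, psd (h p)},
        {in neighbour_pairs ends P, forall p, ampliate (h p) (peps A) = 0},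
        lker (hamiltonian ends P h) = <[peps A]>%VS
      & \dim (lker (hamiltonian ends P h)) = 1%N].
Proof.
(* Since [d] and [D] are positive, label 0 exists everywhere; hence the numbers of configurations
   divided by are nonzero. *)
pose i0 : {ffun V -> 'I_d} := [ffun=> Ordinal d_gt0].
pose c0 : {ffun E -> 'I_D} := [ffun=> Ordinal D_gt0].
have ker := lker_parent_hamiltonian ends_loopless i0 c0 P_covering
  graph_connected P_gt1.
exists (fun p => parent_term A (cover p)); split=> [p _|p _||].
- exact: psd_gram.
- exact: ampliate_parent_term_peps ends_loopless c0 _.
- exact: ker.
- by rewrite [lker _]ker dim_vline (peps_neq0 ends_loopless i0 c0 P_covering).
Qed.
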